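(* The rule of weakening $$\dfrac{\Gamma;P\vdash Q;\Delta}{\Gamma',\Gamma;P',P\vdash Q,Q';\Delta,\Delta'}$$ is admissible in $\mathrm{G3S5}^{;}$, where $\Gamma,\Delta,\Gamma',\Delta'$ are multisets of arbitrary formulas and $P,Q,P',Q'$ are multisets of atomic formulas.
   Context: Formulas: $A::=\bot\mid\top\mid p\mid\neg A\mid A\wedge A\mid A\vee A\mid A\to A\mid\Diamond A\mid\Box A$ ($p$ a propositional variable); $\top$ is read as an abbreviation of $\neg\bot$. Atomic formulas are the variables and $\bot$; modal formulas are those of the form $\Diamond A$ or $\Box A$. Multisets are finite; a comma denotes multiset union; $\neg\Gamma=\{\neg A:A\in\Gamma\}$. $\bigwedge X$, $\bigvee X$ are the conjunction and disjunction of the members of the multiset $X$ (in a fixed order; just the member if $X$ is a singleton). Semicolon sequents. A sequent $\Gamma;P\vdash Q;\Delta$ consists of multisets of formulas $\Gamma,\Delta$, multisets $P,Q$ of atomic formulas (the middle part), and a partition of the occurrences in $P$ and $Q$ into nonempty blocks, each marked as a $\Diamond$-block or a $\Box$-block. A block consisting of $P_0$ from $P$ and $Q_0$ from $Q$ has corresponding formula $\Diamond\bigwedge(P_0,\neg Q_0)$ if it is a $\Diamond$-block and $\Box\bigvee(\neg P_0,Q_0)$ if it is a $\Box$-block. The sequent stands for the ordinary sequent obtained by adding the corresponding formulas of all $\Diamond$-blocks to the antecedent $\Gamma$ and those of all $\Box$-blocks to the succedent $\Delta$. Semicolons next to an empty middle part are omitted; ordinary sequents $\Gamma\vdash\Delta$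 have empty middle part. The system $\mathrm{G3S5}^{;}$ ($M,N$ multisets of modal formulas; $P,Q,P_i,Q_i$ multisets of atomic formulas; $\Gamma,\Delta$ arbitrary; premises before $\Rightarrow$, conclusion after). Axioms: $p,\Gamma;P\vdash Q;\Delta,p$ ($p$ atomic) and $\bot,\Gamma;P\vdash Q;\Delta$. L$\neg$: $\Gamma;P\vdash Q;\Delta,A\ \Rightarrow\ \neg A,\Gamma;P\vdash Q;\Delta$. R$\neg$: $A,\Gamma;P\vdash Q;\Delta\ \Rightarrow\ \Gamma;P\vdash Q;\Delta,\neg A$. L$\vee$: $A,\Gamma;P\vdash Q;\Delta$ and $B,\Gamma;P\vdash Q;\Delta\ \Rightarrow\ A\vee B,\Gamma;P\vdash Q;\Delta$. R$\vee$: $\Gamma;P\vdash Q;\Delta,A,B\ \Rightarrow\ \Gamma;P\vdash Q;\Delta,A\vee B$. L$\wedge$: $A,B,\Gamma;P\vdash Q;\Delta\ \Rightarrow\ A\wedge B,\Gamma;P\vdash Q;\Delta$. R$\wedge$: $\Gamma;P\vdash Q;\Delta,A$ and $\Gamma;P\vdash Q;\Delta,B\ \Rightarrow\ \Gamma;P\vdash Q;\Delta,A\wedge B$. L$\to$: $\Gamma;P\vdash Q;\Delta,A$ and $B,\Gamma;P\vdash Q;\Delta\ \Rightarrow\ A\to B,\Gamma;P\vdash Q;\Delta$. R$\to$: $A,\Gamma;P\vdash Q;\Delta,B\ \Rightarrow\ \Gamma;P\vdash Q;\Delta,A\to B$. R$\Diamond$: $\Gamma;P\vdash Q;\Delta,\Diamond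 A,A\ \Rightarrow\ \Gamma;P\vdash Q;\Delta,\Diamond A$. L$\Box$: $A,\Box A,\Gamma;P\vdash Q;\Delta\ \Rightarrow\ \Box A,\Gamma;P\vdash Q;\Delta$. L$\Diamond$: $A,M;P_1,P_2\vdash Q_2,Q_1;N\ \Rightarrow\ \Diamond A,M,P_1;P_2\vdash Q_2;Q_1,N$. R$\Box$: $M;P_1,P_2\vdash Q_2,Q_1;N,A\ \Rightarrow\ M,P_1;P_2\vdash Q_2;Q_1,N,\Box A$. L$\Diamond^{;}$ and R$\Box^{;}$ (same shape): $M,P_2;P_1,P_3\vdash Q_3,Q_1;Q_2,N\ \Rightarrow\ M,P_1;P_2,P_3\vdash Q_3,Q_2;Q_1,N$. In the rules other than L$\Diamond$, R$\Box$, L$\Diamond^{;}$, R$\Box^{;}$ the marked partition is the same in premises and conclusion. In L$\Diamond$ (resp. R$\Box$) the premise has the blocks of the conclusion together with the new block formed by $P_1,Q_1$, marked $\Box$ (resp. $\Diamond$); no block is added if $P_1,Q_1$ are both empty. In L$\Diamond^{;}$ (resp. R$\Box^{;}$) $P_2,Q_2$ form one $\Diamond$-block (resp. $\Box$-block) of the conclusion; in the premise this block is removed, $P_1,Q_1$ form a new $\Box$-block (resp. $\Diamond$-block; none if empty), and the blocks of $P_3,Q_3$ are unchanged. A rule is admissible if, for each of its instances, provability of all premises in $\mathrm{G3S5}^{;}$ implies provability of the conclusion. In the weakening rule the blocks of the conclusion restrict to those of the premise on $P,Q$ (with the same marks); the new occurrences from $P',Q'$ may be placed in these blocks or in new blocks.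 *)

(* Defs.v *)
From HB Require Import structures.
From mathcomp Require Import all_boot.
From mathcomp Require Import finmap multiset.

Set Implicit Arguments.
Unset Strict Implicit.
Unset Printing Implicit Defensive.

Local Open Scope mset_scope.

Inductive form :=
| Bot
| Var of nat
| Neg of form
| And of form & form
| Or of form & form
| Imp of form & form
| Dia of form
| Box of form.

Definition Top := Neg Bot.

Fixpoint form_encode (A : form) : GenTree.tree nat :=
  match A with
  | Bot => GenTree.Node 0 [::]
  | Var p => GenTree.Leaf p
  | Neg A => GenTree.Node 1 [:: form_encode A]
  | And A B => GenTree.Node 2 [:: form_encode A; form_encode B]
  | Or A B => GenTree.Node 3 [:: form_encode A; form_encode B]
  | Imp A B => GenTree.Node 4 [:: form_encode A; form_encode B]
  | Dia A => GenTree.Node 5 [:: form_encode A]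
  | Box A => GenTree.Node 6 [:: form_encode A]
  end.

Fixpoint form_decode (t : GenTree.tree nat) : form :=
  match t with
  | GenTree.Leaf p => Var p
  | GenTree.Node 1 [:: t] => Neg (form_decode t)
  | GenTree.Node 2 [:: t; u] => And (form_decode t) (form_decode u)
  | GenTree.Node 3 [:: t; u] => Or (form_decode t) (form_decode u)
  | GenTree.Node 4 [:: t; u] => Imp (form_decode t) (form_decode u)
  | GenTree.Node 5 [:: t] => Dia (form_decode t)
  | GenTree.Node 6 [:: t] => Box (form_decode t)
  | _ => Bot
  end.

Lemma form_encodeK : cancel form_encode form_decode.
Proof. by elim=> //= [A ->|A -> B ->|A -> B ->|A -> B ->|A ->|A ->]. Qed.

HB.instance Definition _ := Choice.copy form (can_type form_encodeK).

Definition atomic (A : form) : bool :=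
  match A with Bot | Var _ => true | _ => false end.

Definition modal (A : form) : bool :=
  match A with Dia _ | Box _ => true | _ => false end.

Inductive mark := DiaM | BoxM.

Definition mark_bool (m : mark) : bool := if m is DiaM then true else false.
Definition bool_mark (b : bool) : mark := if b then DiaM else BoxM.

Lemma mark_boolK : cancel mark_bool bool_mark.
Proof. by case. Qed.

HB.instance Definition _ := Choice.copy mark (can_type mark_boolK).

(* A block (m, P0, Q0) consists of its mark, its occurrences from P and its
   occurrences from Q. *)
Definition raw_block : Type := mark * {mset form} * {mset form}.
HB.instance Definition _ := Choice.on raw_block.

Definition is_block (b : raw_block) : bool :=
  [&& all atomic b.1.2, all atomic b.2 & (b.1.2 != mset0) || (b.2 != mset0)].

Definition block : Type := {b : raw_block | is_block b}.
HB.instance Definition _ := Choice.on block.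

Definition bmark (b : block) : mark := (val b).1.1.
Definition bant (b : block) : {mset form} := (val b).1.2.
Definition bsuc (b : block) : {mset form} := (val b).2.

(* Two occurrences of the same formula are indistinguishable, so a middle part
   P |- Q with its marked partition is the multiset of its blocks; P and Q are
   recovered as the unions of the two sides of the blocks. *)
Notation middle := {mset block}.

Definition mid_ant (X : middle) : {mset form} :=
  \big[msetD/mset0]_(b <- enum_mset X) bant b.

Definition mid_suc (X : middle) : {mset form} :=
  \big[msetD/mset0]_(b <- enum_mset X) bsuc b.

(* (G, X, D) is the sequent G; P |- Q; D with P = mid_ant X, Q = mid_suc X. *)
Definition sequent : Type := {mset form} * middle * {mset form}.
HB.instance Definition _ := Choice.on sequent.

(* The block formed by P and Q, or no block if both are empty; it is meant for
   multisets of atomic formulas only ([insub] also fails on the others). *)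
Definition new_block (m : mark) (P Q : {mset form}) : middle :=
  if insub ((m, P, Q) : raw_block) is Some b then [mset b] else mset0.

Inductive provable : sequent -> Prop :=
| AxId G D X p : atomic p ->
    provable (p +` G, X, p +` D)
| AxBot G D X :
    provable (Bot +` G, X, D)
| LNeg G D X A :
    provable (G, X, A +` D) ->
    provable (Neg A +` G, X, D)
| RNeg G D X A :
    provable (A +` G, X, D) ->
    provable (G, X, Neg A +` D)
| LOr G D X A B :
    provable (A +` G, X, D) ->
    provable (B +` G, X, D) ->
    provable (Or A B +` G, X, D)
| ROr G D X A B :
    provable (G, X, A +` (B +` D)) ->
    provable (G, X, Or A B +` D)
| LAnd G D X A B :
    provable (A +` (B +` G), X, D) ->
    provable (And A B +` G, X, D)
| RAnd G D X A B :
    provable (G, X, A +` D) ->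
    provable (G, X, B +` D) ->
    provable (G, X, And A B +` D)
| LImp G D X A B :
    provable (G, X, A +` D) ->
    provable (B +` G, X, D) ->
    provable (Imp A B +` G, X, D)
| RImp G D X A B :
    provable (A +` G, X, B +` D) ->
    provable (G, X, Imp A B +` D)
| RDia G D X A :
    provable (G, X, A +` (Dia A +` D)) ->
    provable (G, X, Dia A +` D)
| LBox G D X A :
    provable (A +` (Box A +` G), X, D) ->
    provable (Box A +` G, X, D)
| LDia (M N P1 Q1 : {mset form}) X A :
    all modal M -> all modal N -> all atomic P1 -> all atomic Q1 ->
    provable (A +` M, new_block BoxM P1 Q1 `+` X, N) ->
    provable (Dia A +` (M `+` P1), X, Q1 `+` N)
| RBox (M N P1 Q1 : {mset form}) X A :
    all modal M -> all modal N -> all atomic P1 -> all atomic Q1 ->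
    provable (M, new_block DiaM P1 Q1 `+` X, A +` N) ->
    provable (M `+` P1, X, Box A +` (Q1 `+` N))
| LDiaSemi (M N P1 Q1 : {mset form}) X b :
    all modal M -> all modal N -> all atomic P1 -> all atomic Q1 ->
    bmark b = DiaM ->
    provable (M `+` bant b, new_block BoxM P1 Q1 `+` X, bsuc b `+` N) ->
    provable (M `+` P1, b +` X, Q1 `+` N)
| RBoxSemi (M N P1 Q1 : {mset form}) X b :
    all modal M -> all modal N -> all atomic P1 -> all atomic Q1 ->
    bmark b = BoxM ->
    provable (M `+` bant b, new_block DiaM P1 Q1 `+` X, bsuc b `+` N) ->
    provable (M `+` P1, b +` X, Q1 `+` N).

(* A rule is the relation between the premises and the conclusion of its
   instances. *)
Definition rule : Type := seq sequent -> sequent -> Prop.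

Definition admissible (R : rule) : Prop :=
  forall (prems : seq sequent) (concl : sequent), R prems concl ->
    (forall S, S \in prems -> provable S) -> provable concl.

(* extends X X': the blocks of X' restrict to those of X. Each block of X' is
   either an enlargement of its own block of X with the same mark, or consists
   of new occurrences only. *)
Inductive extends : middle -> middle -> Prop :=
| ExtNil : extends mset0 mset0
| ExtOld b b' X X' :
    bmark b = bmark b' -> bant b `<=` bant b' -> bsuc b `<=` bsuc b' ->
    extends X X' -> extends (b +` X) (b' +` X')
| ExtNew b' X X' :
    extends X X' -> extends X (b' +` X').

Inductive weakening : rule :=
| Weakening G D G' D' P' Q' X X' :
    extends X X' ->
    mid_ant X' = P' `+` mid_ant X ->
    mid_suc X' = mid_suc X `+` Q' ->
    weakening [:: (G, X, D)] (G' `+` G, X', D `+` D').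

(* Main.v *)
From mathcomp Require Import all_boot finmap multiset zify.
Require Import Defs.

(* An induction on derivations weakens by modal and atomic formulas and, at the
   same time, extends the blocks: in the four modal rules, new modal formulas
   go into M, N, and new atomic ones into P1, Q1, so that they extend the new
   block of the premise; the occurrences added to the principal block appear
   in the premise as atomic formulas. An arbitrary formula, which could not
   pass the modal rules, is then decomposed by its own left or right rule. *)

Set Implicit Arguments.
Unset Strict Implicit.
Unset Printing Implicit Defensive.

Local Open Scope mset_scope.

Ltac mset_ac := apply/msetP => ?; rewrite !msetE2; lia.

Lemma all_msetD (T : choiceType) (p : pred T) (A B : {mset T}) :
  all p (A `+` B) = all p A && all p B.
Proof.
apply/allP/andP => [AB|[/allP pA /allP pB] x].
  by split; apply/allP => x xAB; apply: AB; rewrite in_msetD xAB ?orbT.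
by rewrite in_msetD => /orP[/pA|/pB].
Qed.

Lemma all_msetS (T : choiceType) (p : pred T) (A B : {mset T}) :
  A `<=` B -> all p B -> all p A.
Proof. by move=> /msubset_subset AB /allP pB; apply/allP => x /AB /pB. Qed.

Lemma all_mset1 (T : choiceType) (p : pred T) (a : T) :
  all p [mset a] = p a.
Proof. by rewrite enum_msetn /= andbT. Qed.

Lemma all_mset0 (T : choiceType) (p : pred T) : all p (@mset0 T).
Proof. by rewrite enum_mset0. Qed.

(** Allows a chosen block to be traced through a derivation of [extends], which may have built the
    same multiset in another order. *)
Lemma mset1D_inv (T : choiceType) (a b : T) (A B : {mset T}) :
  a +` A = b +` B ->
  a = b /\ A = B \/ exists C, A = b +` C /\ B = a +` C.
Proof.
move=> eqAB; have [eq_ab|ne_ab] := eqVneq a b.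
  by left; split=> //; apply: (can_inj (msetDKB [mset a])); rewrite eqAB eq_ab.
right; exists (A `\ b).
have bA : b \in A.
  have : b \in a +` A by rewrite eqAB mset1D1.
  by rewrite in_mset1D eq_sym (negPf ne_ab).
split; first by rewrite msetB1K.
apply: (can_inj (msetDKB [mset b])).
by rewrite /= msetDCA msetB1K ?eqAB.
Qed.

Lemma mset_ind (T : choiceType) (P : {mset T} -> Prop) :
  P mset0 -> (forall a A, P A -> P (a +` A)) -> forall A, P A.
Proof.
move=> P0 PD A; rewrite -(seq_mset_id A).
elim: (enum_mset A) => [|a s IH]; last by rewrite mset_cons; apply: PD.
suff -> : seq_mset [::] = mset0 :> {mset T} by [].
by apply/msetP => x; rewrite mset_seqE mset0E.
Qed.

Lemma bant_atomic b : all atomic (bant b).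
Proof. by case/and3P: (valP b). Qed.

Lemma bsuc_atomic b : all atomic (bsuc b).
Proof. by case/and3P: (valP b). Qed.

Lemma extends_refl X : extends X X.
Proof.
elim/mset_ind: X => [|b X IH]; first exact: ExtNil.
by apply: ExtOld; rewrite ?msubset_refl.
Qed.

(** Finds the enlargement of the principal block of a semicolon rule, wherever in the derivation of
    [extends] this block was added. *)
Lemma extendsD1l b X Y : extends (b +` X) Y ->
  exists b' X', [/\ Y = b' +` X', bmark b = bmark b', bant b `<=` bant b',
    bsuc b `<=` bsuc b' & extends X X'].
Proof.
move eqZ: (b +` X) => Z ext; elim: ext b X eqZ => {Z Y}.
(* The multiplicity of [b] is positive on one side and zero in [mset0]. *)
- by move=> b X /(congr1 (fun Z : middle => Z b)); rewrite mset1DE eqxx mset0E.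
- move=> c c' Z Z' eqm sa ss ext IH b X /mset1D_inv[[-> ->]|].
    by exists c', Z'.
  (* Here [b] lies in [Z]; induction finds its enlargement in [Z'], and [c'] joins the remaining
     blocks. *)
  move=> [W [-> eqZ]].
  have [b' [X' [-> *]]] := IH _ _ (esym eqZ).
  exists b', (c' +` X'); split=> //; rewrite 1?msetDCA //.
  exact: ExtOld.
- move=> c' Z Z' ext IH b X /IH[b' [X' [-> *]]].
  exists b', (c' +` X'); split=> //; rewrite 1?msetDCA //.
  exact: ExtNew.
Qed.

Lemma extends_new_block m (P Q P' Q' : {mset form}) X X' :
  all atomic P -> all atomic Q -> all atomic P' -> all atomic Q' ->
  extends X X' ->
  extends (new_block m P Q `+` X)
    (new_block m (P' `+` P) (Q' `+` Q) `+` X').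
Proof.
move=> aP aQ aP' aQ' ext; rewrite /new_block.
have [sP sQ] : P `<=` P' `+` P /\ Q `<=` Q' `+` Q.
  by split; apply/msubsetP => x; rewrite msetE2 leq_addl.
case: insubP => [b isb eqb|_]; case: insubP => [b' _ eqb'|nb'].
- by apply: ExtOld; rewrite // /bmark /bant /bsuc ?eqb ?eqb'.
(* An old block without an enlarged one is impossible: by atomicity only emptiness could make
   [insub] fail, and enlarging keeps a block nonempty. *)
- case/and3P: isb => /= _ _ neq0; case/negP: nb'.
  rewrite /is_block /= !all_msetD aP aQ aP' aQ' /=.
  case/orP: neq0 => [/(msubset_neq0 sP)|/(msubset_neq0 sQ)] -> //.
  by rewrite orbT.
(* [P] and [Q] are empty, so the added formulas form an entirely new block. *)
- by rewrite mset0D; apply: ExtNew.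
- by rewrite !mset0D.
Qed.

Lemma provable_eq G G' D D' X :
  provable (G, X, D) -> G = G' -> D = D' -> provable (G', X, D').
Proof. by move=> ? <- <-. Qed.

(** The additions and [X'] are quantified inside the induction because they change from conclusion
    to premise in the modal rules. Modal and atomic additions are kept apart since these rules treat
    them differently. *)
Lemma provable_weaken_basic S : provable S ->
  forall (M P N Q : {mset form}) X',
    all modal M -> all atomic P -> all modal N -> all atomic Q ->
    extends S.1.2 X' ->
    provable (M `+` P `+` S.1.1, X', N `+` Q `+` S.2).
Proof.
elim=> {S} /=.
- move=> G D X p ap M P N Q X' *.
  by rewrite (msetDCA _ [mset p]) (msetDCA (N `+` Q)); apply: AxId.
- move=> G D X M P N Q X' *.
  by rewrite (msetDCA _ [mset Bot]); apply: AxBot.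
- move=> G D X A _ IH M P N Q X' *.
  rewrite (msetDCA _ [mset Neg A]); apply: LNeg.
  by rewrite -(msetDCA (N `+` Q)); apply: IH.
- move=> G D X A _ IH M P N Q X' *.
  rewrite (msetDCA _ [mset Neg A]); apply: RNeg.
  by rewrite -(msetDCA (M `+` P)); apply: IH.
- move=> G D X A B _ IHA _ IHB M P N Q X' *.
  rewrite (msetDCA _ [mset Or A B]); apply: LOr.
    by rewrite -(msetDCA (M `+` P)); apply: IHA.
  by rewrite -(msetDCA (M `+` P)); apply: IHB.
- move=> G D X A B _ IH M P N Q X' *.
  rewrite (msetDCA _ [mset Or A B]); apply: ROr.
  by rewrite -2!(msetDCA (N `+` Q)); apply: IH.
- move=> G D X A B _ IH M P N Q X' *.
  rewrite (msetDCA _ [mset And A B]); apply: LAnd.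
  by rewrite -2!(msetDCA (M `+` P)); apply: IH.
- move=> G D X A B _ IHA _ IHB M P N Q X' *.
  rewrite (msetDCA _ [mset And A B]); apply: RAnd.
    by rewrite -(msetDCA (N `+` Q)); apply: IHA.
  by rewrite -(msetDCA (N `+` Q)); apply: IHB.
- move=> G D X A B _ IHA _ IHB M P N Q X' *.
  rewrite (msetDCA _ [mset Imp A B]); apply: LImp.
    by rewrite -(msetDCA (N `+` Q)); apply: IHA.
  by rewrite -(msetDCA (M `+` P)); apply: IHB.
- move=> G D X A B _ IH M P N Q X' *.
  rewrite (msetDCA _ [mset Imp A B]); apply: RImp.
  by rewrite -(msetDCA (M `+` P)) -(msetDCA (N `+` Q)); apply: IH.
- move=> G D X A _ IH M P N Q X' *.
  rewrite (msetDCA _ [mset Dia A]); apply: RDia.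
  by rewrite -2!(msetDCA (N `+` Q)); apply: IH.
- move=> G D X A _ IH M P N Q X' *.
  rewrite (msetDCA _ [mset Box A]); apply: LBox.
  by rewrite -2!(msetDCA (M `+` P)); apply: IH.
- move=> M1 N1 P1 Q1 X A mM1 mN1 aP1 aQ1 _ IH M P N Q X' mM aP mN aQ ext.
  apply: (@provable_eq (Dia A +` ((M `+` M1) `+` (P `+` P1))) _
    ((Q `+` Q1) `+` (N `+` N1))); [|by mset_ac|by mset_ac].
  apply: LDia; rewrite ?all_msetD ?mM ?mN ?aP ?aQ //.
  (* Outside the middle part the premise gains only [M] and [N]; [P] and [Q] enter it through the
     new block. *)
  have := IH M mset0 N mset0 (new_block BoxM (P `+` P1) (Q `+` Q1) `+` X').
  rewrite !msetD0 (msetDCA M); apply; rewrite ?all_mset0 //.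
  exact: extends_new_block.
- move=> M1 N1 P1 Q1 X A mM1 mN1 aP1 aQ1 _ IH M P N Q X' mM aP mN aQ ext.
  apply: (@provable_eq ((M `+` M1) `+` (P `+` P1)) _
    (Box A +` ((Q `+` Q1) `+` (N `+` N1)))); [|by mset_ac|by mset_ac].
  apply: RBox; rewrite ?all_msetD ?mM ?mN ?aP ?aQ //.
  have := IH M mset0 N mset0 (new_block DiaM (P `+` P1) (Q `+` Q1) `+` X').
  rewrite !msetD0 (msetDCA N); apply; rewrite ?all_mset0 //.
  exact: extends_new_block.
- move=> M1 N1 P1 Q1 X b mM1 mN1 aP1 aQ1 mb _ IH M P N Q Y mM aP mN aQ.
  move=> /extendsD1l[b' [X' [-> eqm sa ss ext]]].
  apply: (@provable_eq ((M `+` M1) `+` (P `+` P1)) _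
    ((Q `+` Q1) `+` (N `+` N1))); [|by mset_ac|by mset_ac].
  apply: LDiaSemi; rewrite ?all_msetD ?mM ?mN ?aP ?aQ -?eqm //.
  (* The premise now shows the sides of [b'] outside the middle part; what they have beyond those of
     [b] is passed to the induction hypothesis as its atomic additions. *)
  rewrite -{1}(msetBDK sa) -{1}(msetBDK ss).
  have := IH M (bant b' `\` bant b) N (bsuc b' `\` bsuc b)
    (new_block BoxM (P `+` P1) (Q `+` Q1) `+` X').
  move/(_ mM (all_msetS (msubsetDl _ _) (bant_atomic b')) mN).
  move/(_ (all_msetS (msubsetDl _ _) (bsuc_atomic b'))).
  move/(_ (extends_new_block _ aP1 aQ1 aP aQ ext))/provable_eq.
  by apply; mset_ac.
- move=> M1 N1 P1 Q1 X b mM1 mN1 aP1 aQ1 mb _ IH M P N Q Y mM aP mN aQ.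
  move=> /extendsD1l[b' [X' [-> eqm sa ss ext]]].
  apply: (@provable_eq ((M `+` M1) `+` (P `+` P1)) _
    ((Q `+` Q1) `+` (N `+` N1))); [|by mset_ac|by mset_ac].
  apply: RBoxSemi; rewrite ?all_msetD ?mM ?mN ?aP ?aQ -?eqm //.
  rewrite -{1}(msetBDK sa) -{1}(msetBDK ss).
  have := IH M (bant b' `\` bant b) N (bsuc b' `\` bsuc b)
    (new_block DiaM (P `+` P1) (Q `+` Q1) `+` X').
  move/(_ mM (all_msetS (msubsetDl _ _) (bant_atomic b')) mN).
  move/(_ (all_msetS (msubsetDl _ _) (bsuc_atomic b'))).
  move/(_ (extends_new_block _ aP1 aQ1 aP aQ ext))/provable_eq.
  by apply; mset_ac.
Qed.

(** Both sides are treated together because negation and implication move subformulas across the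
    turnstile. The contexts vary in the induction so that two subformulas can be added one after the
    other. *)
Lemma provable_weaken_form A G X D : provable (G, X, D) ->
  provable (A +` G, X, D) /\ provable (G, X, A +` D).
Proof.
have basic B (G1 D1 : {mset form}) : atomic B || modal B ->
    provable (G1, X, D1) ->
    provable (B +` G1, X, D1) /\ provable (G1, X, B +` D1).
  move=> aB pv; have weak := provable_weaken_basic pv.
  have {}weak M P N Q mM aP mN aQ :=
    weak M P N Q X mM aP mN aQ (extends_refl X).
  case/orP: aB => aB; split.
  - have := weak mset0 [mset B] mset0 mset0.
    by rewrite !mset0D; apply; rewrite ?all_mset1 ?all_mset0.
  - have := weak mset0 mset0 mset0 [mset B].
    by rewrite !mset0D; apply; rewrite ?all_mset1 ?all_mset0.
  - have := weak [mset B] mset0 mset0 mset0.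
    by rewrite !mset0D msetD0; apply; rewrite ?all_mset1 ?all_mset0.
  - have := weak mset0 mset0 [mset B] mset0.
    by rewrite !mset0D msetD0; apply; rewrite ?all_mset1 ?all_mset0.
elim: A G D => [|p|A IHA|A IHA B IHB|A IHA B IHB|A IHA B IHB|A _|A _] G D pv;
  try exact: basic.
- by have [pL pR] := IHA _ _ pv; split; [apply: LNeg|apply: RNeg].
- have [pAL pAR] := IHA _ _ pv; have [pBL pBR] := IHB _ _ pv.
  by split; [apply/LAnd; case: (IHA _ _ pBL)|apply: RAnd].
- have [pAL pAR] := IHA _ _ pv; have [pBL pBR] := IHB _ _ pv.
  by split; [apply: LOr|apply/ROr; case: (IHA _ _ pBR)].
- have [pAL pAR] := IHA _ _ pv; have [pBL pBR] := IHB _ _ pv.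
  by split; [apply: LImp|apply/RImp; case: (IHA _ _ pBR)].
Qed.

Lemma provable_weaken G' D' G X D :
  provable (G, X, D) -> provable (G' `+` G, X, D `+` D').
Proof.
move=> pv; rewrite (msetDC D).
elim/mset_ind: G' => [|A G' IH]; last first.
  by rewrite -msetDA; case: (provable_weaken_form A IH).
rewrite mset0D; elim/mset_ind: D' => [|A D' IH]; first by rewrite mset0D.
by rewrite -msetDA; case: (provable_weaken_form A IH).
Qed.

Theorem lemma4p2 : admissible weakening.
Proof.
(* The middle part is first extended to [X'] with empty additions outside it; then [G'] and [D'] are
   added with [X'] fixed. *)
move=> _ _ [G D G' D' P' Q' X X' ext _ _] pv; apply: provable_weaken.
have /pv /provable_weaken_basic weak : (G, X, D) \in [:: (G, X, D)].
  by rewrite inE.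
have := weak mset0 mset0 mset0 mset0 X'.
by rewrite !mset0D; apply; rewrite ?all_mset0.
Qed.
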